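(* Let $X\subseteq\mathbb{R}^2$ be the Knaster-Kuratowski fan. Then $Ab(X)=0$ and $Ind(X)=1$.
   Context: Knaster-Kuratowski fan: let $C$ be the middle-thirds Cantor set in $[0,1]\times\{0\}\subseteq\mathbb{R}^2$ and $z=(\frac12,\frac12)$. For $x\in C$ let $L_x$ be the line segment joining $x$ to $z$. Let $C_1\subseteq C$ be the set of points that are endpoints of intervals removed in the construction of $C$, and $C_2=C\setminus C_1$. For $x\in C_1$ let $\hat L_x=\{(r,s)\in L_x\mid s\in\mathbb{Q}\}$, and for $x\in C_2$ let $\hat L_x=\{(r,s)\in L_x\mid s\notin\mathbb{Q}\}$. The fan is $X=\bigcup_{x\in C}\hat L_x$ with the subspace topology. Large inductive dimension: for a normal space $X$ and disjoint closed $A,B\subseteq X$, a separator between $A$ and $B$ is a closed set $S$ disjoint from $A\cup B$ with $X\setminus S=U\cup V$, where $U,V$ are disjoint open sets containing $A$ and $B$ respectively. $Ind(X)=-1$ iff $X=\emptyset$; for $n\geq 0$, $Ind(X)\leq n$ iff every pair of disjoint closed sets $A,B\subseteq X$ has a separator $S$ with $Ind(S)\leq n-1$. $Ind(X)$ is the least $n$ with $Ind(X)\leq n$, and $\infty$ if there is none. All spaces are Hausdorff, and subsets carry the subspace topology. A continuum is a compact, connected, Hausdorff space. For a space $Y$ and points $x,z\in Y$, $\mathcal{C}(x,z,Y)$ denotes the collection of open connected subsets of $Y$ containing both $x$ and $z$. $cl_Y$ and $\partial_Y$ denote closure and boundary in $Y$. Line of sight: let $Y$ be a nonempty Hausdorff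 space, $x,z\in Y$ distinct points, and $K\subseteq Y\setminus\{z\}$ a subspace containing $x$. A continuum $C\subseteq Y$ containing $x$ and $z$ is a line of sight (in $Y$, with respect to $K$) from $z$ to $x$ if: (i) $\mathcal{C}(x,z,Y)$ contains a neighborhood basis for $C$, i.e. every open subset of $Y$ containing $C$ contains an element of $\mathcal{C}(x,z,Y)$ that contains $C$; and (ii) for every $U\subseteq K$ open in $K$ with $x\in U$ there is $V_U\in\mathcal{C}(x,z,Y)$ with $C\subseteq V_U$ and $V_U\cap K\subseteq cl_Y(V_U)\cap K\subseteq U$. Abbott dimension: let $X$ be a nonempty Hausdorff space. Let $X_0$ be the power set of $X$. Given $X_n$ ($n\geq 0$), let $X_{n+1}$ be the collection of all $Y\subseteq X$ for which there is a nonempty $K\in X_n$ such that (1) $K\subseteq Y$; and (2) there is a point $z\in Y\setminus K$ such that for every $x\in K$ there is a line of sight $W_{z,x}\subseteq Y$ (in $Y$, with respect to $K$) from $z$ to $x$ with the following property: there is $V\in\mathcal{C}(x,z,Y)$ containing $W_{z,x}$ such that whenever $V'\in\mathcal{C}(x,z,Y)$ satisfies $W_{z,x}\subseteq V'\subseteq V$, there is $D\subseteq\partial_Y(V')$ with $D\in X_n$. Then $Ab(X)$ is the greatest $n$ with $X_n\neq\emptyset$, and $Ab(X)=\infty$ if $X_n\neq\emptyset$ for all $n$. Also $Ab(\emptyset)=-1$. *)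

(* Defs.v *)
From mathcomp Require Import all_boot all_order all_algebra.
From mathcomp Require Import all_classical all_reals all_analysis.

Set Implicit Arguments.
Unset Strict Implicit.
Unset Printing Implicit Defensive.

Import Order.TTheory GRing.Theory Num.Theory.
Import numFieldNormedType.Exports.

Local Open Scope classical_set_scope.
Local Open Scope ring_scope.

(* Dimensions take values in {-1, 0, 1, ...} \cup {oo}, inside [\bar int].
   For [A : set T], the type [set_type A] (a coercion) carries the subspace
   topology. *)

(** * The Knaster-Kuratowski fan *)

Section Fan.
Context {R : realType}.
Implicit Types (J : R * R) (x z p : R * R).

(* The pair [J] stands for the interval [J.1, J.2]; its open middle third is
   ]third1 J, third2 J[. *)
Definition third1 J : R := J.1 + (J.2 - J.1) / 3.
Definition third2 J : R := J.2 - (J.2 - J.1) / 3.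

(* The intervals left at stage [n] of the construction of the Cantor set. *)
Fixpoint cantor_intervals (n : nat) : seq (R * R) :=
  if n is m.+1 then
    flatten [seq [:: (J.1, third1 J); (third2 J, J.2)]
            | J <- cantor_intervals m]
  else [:: (0, 1)].

Definition cantor_set : set R :=
  \bigcap_n \bigcup_(J in [set` cantor_intervals n]) `[J.1, J.2]%classic.

Definition cantor_base : set (R * R) := [set (x, 0) | x in cantor_set].

(* Only endpoints of removed intervals: 0 and 1 are not among them. *)
Definition cantor_base1 : set (R * R) := cantor_base `&`
  [set x | exists n J, J \in cantor_intervals n /\
                       (x = (third1 J, 0) \/ x = (third2 J, 0))].

Definition cantor_base2 : set (R * R) := cantor_base `\` cantor_base1.

Definition segment x z : set (R * R) :=
  [set p | exists2 t : R, 0 <= t <= 1 &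
           p = ((1 - t) * x.1 + t * z.1, (1 - t) * x.2 + t * z.2)].

Definition fan_apex : R * R := (1 / 2, 1 / 2).

Definition fan : set (R * R) :=
  (\bigcup_(x in cantor_base1) (segment x fan_apex `&` [set p | rational p.2]))
  `|`
  (\bigcup_(x in cantor_base2) (segment x fan_apex `&` [set p | irrational p.2])).

End Fan.
Arguments fan : clear implicits.

(** * Large inductive dimension *)

Definition is_separator (T : topologicalType) (A B S : set T) : Prop :=
  [/\ closed S, S `&` (A `|` B) = set0 &
      exists U V : set T,
        [/\ open U, open V, U `&` V = set0, ~` S = U `|` V &
            A `<=` U /\ B `<=` V]].

(* [Ind_lt n T] means Ind(T) <= n - 1; the shift makes -1 the base case. *)
Fixpoint Ind_lt (n : nat) (T : topologicalType) : Prop :=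
  if n is m.+1 then
    forall A B : set T, closed A -> closed B -> A `&` B = set0 ->
      exists S : set T, is_separator A B S /\ Ind_lt m (set_type S)
  else [set: T] = set0.

Definition Ind (T : topologicalType) : \bar int :=
  xget +oo%E [set d | exists n : nat,
    [/\ d = (n%:Z - 1)%:E, Ind_lt n T & forall m, Ind_lt m T -> (n <= m)%N]].

(** * Abbott dimension *)

Definition boundary (T : topologicalType) (A : set T) : set T :=
  closure A `\` A^°.

Definition continuum (T : topologicalType) (C : set T) : Prop :=
  [/\ compact C, connected C & hausdorff_space (set_type C)].

Definition open_connected (Y : topologicalType) (x z : Y) : set (set Y) :=
  [set V | [/\ open V, connected V, V x & V z]].

(* [C] is a line of sight in [Y], with respect to [K], from [z] to [x]. *)
Definition line_of_sight (Y : topologicalType) (K : set Y) (z x : Y)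
    (C : set Y) : Prop :=
  [/\ [/\ x <> z, K x & ~ K z],
      [/\ continuum C, C x & C z],
      (forall O : set Y, open O -> C `<=` O ->
         exists V, [/\ open_connected x z V, C `<=` V & V `<=` O]) &
      (forall U : set Y, (exists2 O, open O & U = K `&` O) -> U x ->
         exists V, [/\ open_connected x z V, C `<=` V,
                       V `&` K `<=` closure V `&` K &
                       closure V `&` K `<=` U])].

(* The collections X_n; [Y] is regarded as a space in its own right, so the
   subsets [K] and [D] of [X] are transported along [set_val : Y -> X]. *)
Fixpoint Ab_family (X : topologicalType) (n : nat) : set (set X) :=
  if n is m.+1 then
    [set Y : set X | exists K : set X,
      [/\ Ab_family m K, K !=set0, K `<=` Y &
        let KY : set (set_type Y) := set_val @^-1` K in
        exists z : set_type Y, ~ KY z /\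
          forall x : set_type Y, KY x ->
            exists W : set (set_type Y), line_of_sight KY z x W /\
              exists V, [/\ open_connected x z V, W `<=` V &
                forall V', open_connected x z V' -> W `<=` V' -> V' `<=` V ->
                  exists D : set (set_type Y),
                    D `<=` boundary V' /\ Ab_family m (set_val @` D)]]]
  else setT.
Arguments Ab_family : clear implicits.

(* [Ab_family X n !=set0] is decreasing in [n], so when no greatest such [n]
   exists, all the collections are nonempty. *)
Definition Ab (X : topologicalType) : \bar int :=
  if `[< [set: X] = set0 >] then (-1)%:E
  else xget +oo%E [set d | exists n : nat,
    [/\ d = (n%:Z)%:E, Ab_family X n !=set0 &
        forall m, Ab_family X m !=set0 -> (m <= n)%N]].

(* Main.v *)
(* The fan contains no nondegenerate continuum, hence no line of sight, so its
   Abbott dimension is [0].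

   The fan is connected (Baire category in the Cantor set) and has more than one
   point, so [Ind > 0]. For [Ind <= 1], let [f] be a Urysohn function for the
   two given closed sets. The points of rational height are countably many, so
   [f] avoids on them some value [r] in ]0, 1[. The separator [f = r] consists
   of points of irrational height, and such a set has a countable clopen
   basis. *)
Require Import Defs.
From mathcomp Require Import all_boot all_order all_algebra.
From mathcomp Require Import all_classical all_reals all_analysis.
From mathcomp Require Import ring lra.
Import Order.TTheory GRing.Theory Num.Theory numFieldNormedType.Exports.

Set Implicit Arguments.
Unset Strict Implicit.
Unset Printing Implicit Defensive.

Local Open Scope classical_set_scope.
Local Open Scope ring_scope.

(** * Intervals of the Cantor set *)

Section CantorSet.
Context {R : realType}.
Implicit Types (J K : R * R) (x y : R).

Lemma cantor_intervalsS n K :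
  K \in cantor_intervals n.+1 <->
  exists2 J : R * R, J \in cantor_intervals n &
    K = (J.1, third1 J) \/ K = (third2 J, J.2).
Proof.
split.
  case/flatten_mapP => J Jn; rewrite !inE => /orP[] /eqP ->; exists J => //.
    by left.
  by right.
move=> [J Jn KJ]; apply/flatten_mapP; exists J => //.
by rewrite !inE; apply/orP; case: KJ => ->; [left|right].
Qed.

Lemma cantor_interval_length n J :
  J \in cantor_intervals n -> J.2 - J.1 = 3^-1 ^+ n.
Proof.
elim: n J => [|n IHn] J; first by rewrite inE => /eqP -> /=; rewrite subr0.
move=> /cantor_intervalsS[K /IHn lK].
by rewrite exprS -lK /third1 /third2; case=> -> /=; lra.
Qed.

Lemma cantor_interval_lt n J : J \in cantor_intervals n -> J.1 < J.2.
Proof.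
by move=> /cantor_interval_length lJ; rewrite -subr_gt0 lJ exprn_gt0.
Qed.

Lemma small_cantor_interval (e : R) : 0 < e -> exists m,
  forall n J, (m <= n)%N -> J \in cantor_intervals n -> J.2 - J.1 < e.
Proof.
move=> e0; have /(_ _)/cvgrPdist_lt/(_ e e0) := @cvg_expr R 3^-1.
case; first by rewrite ger0_norm; lra.
move=> m _ me; exists m => n J mn /cantor_interval_length ->.
have /= := me n mn; rewrite sub0r normrN ger0_norm// exprn_ge0//; lra.
Qed.

(** By induction the parents share [x] and so coincide, and the two outer thirds of one interval are
    separated by its middle third. *)
Lemma cantor_intervals_disjoint n J K x :
  J \in cantor_intervals n -> K \in cantor_intervals n ->
  J.1 <= x <= J.2 -> K.1 <= x <= K.2 -> J = K.
Proof.
elim: n J K => [|n IHn] J K; first by rewrite !inE => /eqP-> /eqP->.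
move=> /cantor_intervalsS[J' J'n JJ'] /cantor_intervalsS[K' K'n KK'] xJ xK.
have J'lt := cantor_interval_lt J'n; have K'lt := cantor_interval_lt K'n.
have eqJK : J' = K'.
  apply: IHn => //.
    by case: JJ' xJ => -> /=; rewrite /third1 /third2; lra.
  by case: KK' xK => -> /=; rewrite /third1 /third2; lra.
subst K'; move: JJ' KK' xJ xK.
by rewrite /third1 /third2 => -[] -> [] -> //= *; exfalso; lra.
Qed.

Lemma cantor_interval_parent m n K : (m <= n)%N -> K \in cantor_intervals n ->
  exists2 J, J \in cantor_intervals m & J.1 <= K.1 /\ K.2 <= J.2.
Proof.
move=> /subnK <-; elim: (n - m)%N K => [|k IHk] K.
  by move=> Kn; exists K.
rewrite addSn => /cantor_intervalsS[J /[dup] /cantor_interval_lt ltJ].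
move=> /IHk[J' J'm JJ'] KJ; exists J' => //.
by case: KJ => -> /=; rewrite /third1 /third2; lra.
Qed.

Lemma cantor_interval_child m n J : (m <= n)%N -> J \in cantor_intervals m ->
  exists2 K, K \in cantor_intervals n & J.1 <= K.1 /\ K.2 <= J.2.
Proof.
move=> /subnK <- Jm; elim: (n - m)%N => [|k [K Kk KJ]]; first by exists J.
have ltK := cantor_interval_lt Kk.
exists (K.1, third1 K) => /=; first by apply/cantor_intervalsS; exists K; auto.
by rewrite /third1; lra.
Qed.

Lemma cantor_set_interval x n : cantor_set x ->
  exists2 J, J \in cantor_intervals n & J.1 <= x <= J.2.
Proof. by move=> /(_ n I)[J Jn]; rewrite /= in_itv/= => xJ; exists J. Qed.

(** The stages are nested, so lying in arbitrarily late ones is enough. *)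
Lemma cantor_set_frequently x :
  (forall m, exists n J, [/\ (m <= n)%N, J \in cantor_intervals n &
                             J.1 <= x <= J.2]) ->
  cantor_set x.
Proof.
move=> xC m _; have [n [J [mn Jn xJ]]] := xC m.
have [K Km KJ] := cantor_interval_parent mn Jn.
by exists K => //=; rewrite in_itv/=; lra.
Qed.

Lemma cantor_set_endpoint n J x :
  J \in cantor_intervals n -> x = J.1 \/ x = J.2 -> cantor_set x.
Proof.
move=> Jn xJ; apply: cantor_set_frequently => m.
suff [K Kmn xK] : exists2 K, K \in cantor_intervals (m + n) &
    x = K.1 \/ x = K.2.
  exists (m + n)%N, K; split => //; first exact: leq_addr.
  by have := cantor_interval_lt Kmn; case: xK => ->; lra.
elim: m => [|m [K Kmn xK]]; first by exists J.
case: xK => xK.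
- exists (K.1, third1 K); last by left.
  by rewrite addSn; apply/cantor_intervalsS; exists K; auto.
- exists (third2 K, K.2); last by right.
  by rewrite addSn; apply/cantor_intervalsS; exists K; auto.
Qed.

(** Every interval of every stage contains such a point, so these points are dense in the Cantor
    set. *)
Lemma third1_cantor_base1 n J :
  J \in cantor_intervals n -> cantor_base1 (third1 J, 0).
Proof.
move=> Jn; split; last by exists n, J; split => //; left.
exists (third1 J) => //; apply: (@cantor_set_endpoint n.+1 (J.1, third1 J)).
  by apply/cantor_intervalsS; exists J; auto.
by right.
Qed.

Lemma middle_third_notin_cantor n J x :
  J \in cantor_intervals n -> third1 J < x < third2 J -> ~ cantor_set x.
Proof.
move=> Jn xJ /(@cantor_set_interval _ n.+1)[K].
move=> /cantor_intervalsS[J' J'n KJ'] xK.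
have ltJ := cantor_interval_lt Jn; have ltJ' := cantor_interval_lt J'n.
have JJ' : J = J'.
  apply: (@cantor_intervals_disjoint n _ _ x) => //.
    by move: xJ; rewrite /third1 /third2; lra.
  by case: KJ' xK => -> /=; rewrite /third1 /third2; lra.
by subst J'; case: KJ' xK xJ => -> /=; rewrite /third1 /third2; lra.
Qed.

(** If a rational taken in between lies in the Cantor set, a short enough interval around it has a
    middle third that still fits, and any rational in that third will do. Rational gaps keep the
    family of cones used later countable. *)
Lemma rat_notin_cantor x y : x < y ->
  exists q : rat, x < ratr q < y /\ ~ cantor_set (ratr q : R).
Proof.
move=> /rat_in_itvoo[p]; rewrite in_itv/= => xpy.
have [pC|pC] := pselect (cantor_set (ratr p : R)); last by exists p.
have [|m small] := @small_cantor_interval (Num.min (ratr p - x) (y - ratr p)).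
  by rewrite lt_min; lra.
have [J Jm pJ] := cantor_set_interval m pC.
have := small _ _ (leqnn m) Jm; rewrite lt_min => lJ.
have ltJ := cantor_interval_lt Jm.
have /rat_in_itvoo[q] : third1 J < third2 J by rewrite /third1 /third2; lra.
rewrite in_itv/= => Jq; exists q; split.
  by move: Jq; rewrite /third1 /third2; lra.
exact: middle_third_notin_cantor Jm Jq.
Qed.

Lemma cantor_intervals_rational n J :
  J \in cantor_intervals n -> rational J.1 /\ rational J.2.
Proof.
elim: n J => [|n IHn] J.
  rewrite inE => /eqP -> /=.
  by split; [exists 0|exists 1]; rewrite ?raddf0 ?rmorph1.
move=> /cantor_intervalsS[K /IHn[[a _ aK] [b _ bK]]].
rewrite /third1 /third2 -aK -bK => -[] -> /=.
  split; first by exists a.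
  exists (a + (b - a) / 3) => //.
  by rewrite rmorphD rmorphM rmorphB fmorphV rmorph_nat.
split; last by exists b.
exists (b - (b - a) / 3) => //.
by rewrite rmorphB rmorphM rmorphB fmorphV rmorph_nat.
Qed.

Lemma cantor_base1_rational x : cantor_base1 (x, 0) -> rational x.
Proof.
move=> [_ [n [J [Jn]]]].
have J1 : (J.1, third1 J) \in cantor_intervals n.+1.
  by apply/cantor_intervalsS; exists J; auto.
have J2 : (third2 J, J.2) \in cantor_intervals n.+1.
  by apply/cantor_intervalsS; exists J; auto.
by case=> -[->]; [case: (cantor_intervals_rational J1)|
                  case: (cantor_intervals_rational J2)].
Qed.

(** Baire category theorem for the Cantor set: every interval of the construction contains another
    one missing [F i], and nested choices for successive [i] have a common point. *)
Lemma cantor_baire (F : nat -> set R) n0 J0 : J0 \in cantor_intervals n0 ->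
  (forall i n J, J \in cantor_intervals n ->
    exists n' K, [/\ K \in cantor_intervals n', J.1 <= K.1, K.2 <= J.2 &
      forall x, K.1 <= x <= K.2 -> ~ F i x]) ->
  exists x, [/\ cantor_set x, J0.1 <= x <= J0.2 & forall i, ~ F i x].
Proof.
move=> J0n0 avoidF.
pose S := {u : nat * (R * R) | u.2 \in cantor_intervals u.1}.
have next (p : nat * S) : {u : S | [/\ ((sval p.2).1 < (sval u).1)%N,
    (sval p.2).2.1 <= (sval u).2.1, (sval u).2.2 <= (sval p.2).2.2 &
    forall x, (sval u).2.1 <= x <= (sval u).2.2 -> ~ F p.1 x]}.
  apply: cid; case: p => i [[n J] /= Jn].
  have [n' [K [Kn' JK KJ KF]]] := avoidF i n J Jn.
  (* Going one stage beyond both [n] and [n'] makes the stages strictly increase, which puts the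
     limit point in the Cantor set. *)
  have [K' K'n [KK' K'K]] :=
    cantor_interval_child (leq_trans (leq_maxl n' n) (leqnSn _)) Kn'.
  exists (exist _ ((maxn n' n).+1, K') K'n) => /=; split.
  - by rewrite ltnS leq_maxr.
  - lra.
  - lra.
  - by move=> x xK'; apply: KF; lra.
pose fix J_ i : S :=
  if i is i'.+1 then sval (next (i', J_ i')) else exist _ (n0, J0) J0n0.
pose l i := (sval (J_ i)).2.1; pose r i := (sval (J_ i)).2.2.
have JS i : [/\ ((sval (J_ i)).1 < (sval (J_ i.+1)).1)%N, l i <= l i.+1,
    r i.+1 <= r i & forall x, l i.+1 <= x <= r i.+1 -> ~ F i x].
  by rewrite /l /r /=; case: (next _).
have lr i : l i < r i by have /= /cantor_interval_lt := svalP (J_ i).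
have l_ndecr : {homo l : i j / (i <= j)%N >-> i <= j}.
  by apply/nondecreasing_seqP => i; case: (JS i).
have r_nincr : {homo r : i j / (i <= j)%N >-> j <= i}.
  by apply/nonincreasing_seqP => i; case: (JS i).
have lr' i j : l i <= r j.
  apply: (le_trans (l_ndecr i (maxn i j) (leq_maxl _ _))).
  exact: (le_trans (ltW (lr _)) (r_nincr _ _ (leq_maxr _ _))).
have ubl j : ubound (range l) (r j) by move=> _ [i _ <-]; exact: lr'.
pose x := sup (range l).
have xlr i : l i <= x <= r i.
  apply/andP; split; last by apply: ge_sup => //; exists (l 0%N), 0%N.
  by apply: ub_le_sup; [exists (r 0%N)|exists i].
exists x; split.
- apply: cantor_set_frequently => m.
  exists (sval (J_ m)).1, (sval (J_ m)).2; split; last exact: xlr.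
    elim: m => // m IHm; case: (JS m) => + _ _ _.
    exact: leq_ltn_trans.
  by case: (J_ m).
- exact: xlr 0%N.
- by move=> i; have [_ _ _] := JS i; apply; exact: xlr.
Qed.

End CantorSet.

(** * Geometry of the fan *)

(** Otherwise the trace of [U] on [A] would be clopen in [A], nonempty and, because of the point in
    [V], proper. *)
Lemma connected_open_cover (T : topologicalType) (A U V : set T) :
  connected A -> open U -> open V -> A `<=` U `|` V ->
  A `&` U !=set0 -> A `&` V !=set0 -> A `&` (U `&` V) !=set0.
Proof.
move=> cA oU oV AUV AU0 [v [Av Vv]].
have [//|/nonemptyPn AUV0] := pselect (A `&` (U `&` V) !=set0).
have AU : A `&` U = A `&` ~` V.
  rewrite eqEsubset; split=> x [Ax] => [Ux|nVx].
    by split=> // Vx; move: AUV0; rewrite -subset0 => /(_ x); apply.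
  by split=> //; have [] := AUV x Ax.
have : A `&` U = A.
  apply: cA => //; first by exists U.
  by exists (~` V) => //; exact: open_closedC.
by rewrite AU => AV; move: Av; rewrite -AV => -[].
Qed.

Section Fan.
Context {R : realType}.
Implicit Types (x s : R) (p : R * R).

Lemma countable_rational : countable (@rational R).
Proof. exact: card_le_trans (card_image_le _ _) (countableP _). Qed.

(** A countable set is Lebesgue-null, whereas a nonempty open interval is not. *)
Lemma notin_countable (A : set R) (a b : R) : countable A -> a < b ->
  exists r, a < r < b /\ ~ A r.
Proof.
move=> cA ab; apply: contrapT => nA.
have : countable (`]a, b[%classic : set R).
  apply: sub_countable cA; apply: subset_card_le => r.
  rewrite /= in_itv/= => rab.
  by apply: contrapT => nAr; apply: nA; exists r.
move=> /countable_lebesgue_measure0; rewrite lebesgue_measure_itv/= lte_fin ab.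
by move=> /eqP; rewrite -EFinB eqe; lra.
Qed.

(** The point at height [s] on the line from [(x, 0)] to the apex, which is reached at [s = 1 / 2].
    The height replaces the parameter of [segment] because rationality of heights defines the
    fan. *)
Definition ray x s : R * R := ((1 - 2 * s) * x + s, s).

Lemma ray_inj x x' s s' : s < 1 / 2 -> ray x s = ray x' s' -> x = x' /\ s = s'.
Proof.
move=> s2 [+ ss']; rewrite -ss' => /eqP xx'; split=> //.
apply: (@mulfI _ (1 - 2 * s)); first by apply/eqP; lra.
by apply/eqP; move: xx'; lra.
Qed.

Lemma ray_apex x : ray x (1 / 2) = fan_apex.
Proof. by rewrite /ray /fan_apex; congr (_, _); lra. Qed.

Lemma segment_ray x p : segment (x, 0) fan_apex p <->
  exists2 s, 0 <= s <= 1 / 2 & p = ray x s.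
Proof.
split=> [[t t01 ->]|[s s2 ->]] /=.
  by exists (t / 2); [lra|rewrite /ray; congr (_, _); lra].
by exists (2 * s); [lra|rewrite /ray; congr (_, _) => /=; lra].
Qed.

(** One equivalence covers both unions. At the apex [p] does not determine [x], but the height 1/2
    is rational, so [x] then comes from [cantor_base1]. *)
Lemma fanP p : fan R p <-> exists x s, [/\ cantor_set x, 0 <= s <= 1 / 2,
  p = ray x s & cantor_base1 (x, 0) <-> rational s].
Proof.
split=> [[] [y]|[x [s [xC s2 pE xs]]]].
- move=> yC1 [+ pQ]; have [[x xC xy] _] := yC1.
  rewrite -xy => /segment_ray[s s2 pE]; exists x, s; split=> //.
  by rewrite pE in pQ; rewrite xy.
- move=> [[x xC <-] yC1] [/segment_ray[s s2 pE] pQ]; exists x, s; split=> //.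
  by rewrite pE in pQ.
- have [x1|x1] := pselect (cantor_base1 (x, 0)); [left|right].
    exists (x, 0) => //; split; first by apply/segment_ray; exists s.
    by rewrite pE; exact/xs.
  exists (x, 0); first by split=> //; exists x.
  split; first by apply/segment_ray; exists s.
  by rewrite pE => /xs.
Qed.

Lemma fan_ray x s : cantor_set x -> 0 <= s <= 1 / 2 ->
  (cantor_base1 (x, 0) <-> rational s) -> fan R (ray x s).
Proof. by move=> xC s2 xs; apply/fanP; exists x, s. Qed.

Lemma fan_rayE x s : 0 <= s < 1 / 2 -> fan R (ray x s) ->
  cantor_set x /\ (cantor_base1 (x, 0) <-> rational s).
Proof.
move=> s2 /fanP[x' [s' [x'C s'2 /ray_inj[|-> ->]]]]; first lra.
by split.
Qed.

Lemma fan_apex_in : fan R fan_apex.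
Proof.
rewrite -(ray_apex (third1 (0, 1))).
have x1 : cantor_base1 (third1 (0, 1) : R, 0).
  by apply: (@third1_cantor_base1 _ 0); rewrite inE.
apply: fan_ray; [by have [[? ? [<-]]] := x1|lra|split=> // _].
by exists (1 / 2) => //; rewrite fmorph_div rmorph1 rmorph_nat.
Qed.

Lemma ray_continuous x : continuous (ray x).
Proof.
move=> s.
have ray1 : (1 - 2 * t) * x + t @[t --> s] --> (1 - 2 * s) * x + s.
  apply: cvgD; last exact: cvg_id.
  apply: cvgMr_tmp; apply: cvgB; first exact: cvg_cst.
  by apply: cvgMl_tmp; exact: cvg_id.
exact: (cvg_pair ray1 (@cvg_id _ (nbhs s))).
Qed.

Lemma ray_continuousl s : continuous (ray ^~ s).
Proof.
move=> x.
have ray1 : (1 - 2 * s) * y + s @[y --> x] --> (1 - 2 * s) * x + s.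
  by apply: cvgD; [apply: cvgMl_tmp; exact: cvg_id|exact: cvg_cst].
have ray2 : s @[y --> x] --> s by exact: cvg_cst.
exact: (cvg_pair ray1 ray2).
Qed.

Lemma ray_continuous2 : continuous (fun u : R * R => ray u.1 u.2).
Proof.
move=> p.
have ray1 : (1 - 2 * u.2) * u.1 + u.2 @[u --> p] --> (1 - 2 * p.2) * p.1 + p.2.
  apply: cvgD; last exact: cvg_snd.
  apply: cvgM; last exact: cvg_fst.
  apply: cvgB; first exact: cvg_cst.
  by apply: cvgMl_tmp; exact: cvg_snd.
exact: (cvg_pair ray1 (@cvg_snd _ _ _ _ _)).
Qed.

(** * Open half-planes and cones at the apex *)

Lemma snd_continuous : continuous (fun p : R * R => p.2).
Proof. by move=> p; exact: cvg_snd. Qed.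

(** At [ray x s] the value is [(1 - 2 * s) * (x - a)], so below the apex its sign compares [x] with
    [a]. *)
Lemma cone_continuous a :
  continuous (fun p : R * R => p.1 - p.2 - (1 - 2 * p.2) * a).
Proof.
move=> p; apply: cvgB; first by apply: cvgB; [exact: cvg_fst|exact: cvg_snd].
apply: cvgMr_tmp; apply: cvgB; first exact: cvg_cst.
by apply: cvgMl_tmp; exact: cvg_snd.
Qed.

Lemma open_below s : open [set p : R * R | p.2 < s].
Proof.
apply: (@open_comp _ _ (fun p : R * R => p.2) [set x | x < s]) => [p _|].
  exact: snd_continuous.
exact: open_lt.
Qed.

Lemma open_above s : open [set p : R * R | s < p.2].
Proof.
apply: (@open_comp _ _ (fun p : R * R => p.2) [set x | s < x]) => [p _|].
  exact: snd_continuous.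
exact: open_gt.
Qed.

Lemma open_left a : open [set p : R * R | p.1 - p.2 < (1 - 2 * p.2) * a].
Proof.
rewrite (_ : [set _ | _] =
  (fun p : R * R => p.1 - p.2 - (1 - 2 * p.2) * a) @^-1` [set x | x < 0]).
  by apply: open_comp => [p _|]; [exact: cone_continuous|exact: open_lt].
by apply/funext => p /=; rewrite subr_lt0.
Qed.

Lemma open_right a : open [set p : R * R | (1 - 2 * p.2) * a < p.1 - p.2].
Proof.
rewrite (_ : [set _ | _] =
  (fun p : R * R => p.1 - p.2 - (1 - 2 * p.2) * a) @^-1` [set x | 0 < x]).
  by apply: open_comp => [p _|]; [exact: cone_continuous|exact: open_gt].
by apply/funext => p /=; rewrite subr_gt0.
Qed.

Lemma open_cone a b s : open [set p : R * R | p.2 < s /\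
  (1 - 2 * p.2) * a < p.1 - p.2 < (1 - 2 * p.2) * b].
Proof.
rewrite (_ : [set _ | _] = [set p : R * R | p.2 < s] `&`
  ([set p : R * R | (1 - 2 * p.2) * a < p.1 - p.2] `&`
   [set p : R * R | p.1 - p.2 < (1 - 2 * p.2) * b])).
  apply: openI; first exact: open_below.
  by apply: openI; [exact: open_right|exact: open_left].
by apply/seteqP; split => p /= [ps]; [move=> /andP[]|case=> -> ->].
Qed.

(** Together with the cone of [open_cone] this leaves out only points at height [s] or on the lines
    from [(a, 0)] and [(b, 0)] to the apex. *)
Lemma open_cone_exterior a b s : open [set p : R * R | s < p.2 \/
  p.1 - p.2 < (1 - 2 * p.2) * a \/ (1 - 2 * p.2) * b < p.1 - p.2].
Proof.
exact: openU (@open_above s) (openU (@open_left a) (@open_right b)).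
Qed.

(* A continuum in the fan with a point on the ray of [c] below another of its
   points must meet that ray at every height in between, since a missing
   height, together with two gaps of the Cantor set around [c], cuts it. But
   some of these heights are not in the fan. *)
Lemma punctiform_fan (W : set (R * R)) : compact W -> connected W ->
  W `<=` fan R -> is_subset1 W.
Proof.
move=> cptW conW Wfan.
suff main u v : W u -> W v -> u.2 <= v.2 -> u = v.
  by move=> u v Wu Wv; have [/main|/ltW/main] := leP u.2 v.2;
    [exact|move=> /(_ Wv Wu)].
move=> Wu Wv; apply: contraPP => uv.
have /fanP[c [s [cC s2 uE cs]]] := Wfan u Wu.
have /fanP[d [t [dC t2 vE dt]]] := Wfan v Wv.
rewrite uE vE /= => st.
have {}s2 : 0 <= s < 1 / 2.
  have [||ss] := ltgtP s (1 / 2); [lra|lra|].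
  have tt : t = 1 / 2 by lra.
  by case: uv; rewrite uE vE ss tt !ray_apex.
have {}uv : s < t \/ s = t /\ c <> d.
  have [|//|ss] := ltgtP s t; [by left|lra|right; split => // cd].
  by case: uv; rewrite uE vE ss cd.
(* If [v] is higher than [u], the missing height must lie below [v]; at equal heights any height
   below the apex serves, since [v] is then excluded sideways. *)
pose m := if s < t then t else 1 / 2.
have sm : s < m <= 1 / 2 by rewrite /m; case: ifPn => // ?; lra.
have [h [shm hX]] : exists h, s < h < m /\ ~ fan R (ray c h).
  suff [h [shm hc]] : exists h, s < h < m /\
      ~ (cantor_base1 (c, 0) <-> rational h).
    by exists h; split=> // /fan_rayE[|_ //]; lra.
  (* Rays over [cantor_base1] lack the irrational heights, the others lack the rational ones. *)
  have [c1|c1] := pselect (cantor_base1 (c, 0)).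
    have [|h [shm hQ]] := notin_countable countable_rational (_ : s < m).
      lra.
    by exists h; split=> // -[/(_ c1)].
  have [|q] := @rat_in_itvoo _ s m; first lra.
  rewrite in_itv/= => smq; exists (ratr q); split=> // -[_].
  by apply: contra_not c1; apply; exists q.
(* [W] is closed, so neighbouring rays miss [W] at height [h] as well. *)
have [e e0 eW] : exists2 e, 0 < e & forall x, `|c - x| < e -> ~ W (ray x h).
  have oW : open (~` W).
    by apply: closed_openC; apply: compact_closed => //; exact: norm_hausdorff.
  have : nbhs c ((ray ^~ h) @^-1` (~` W)).
    apply: ray_continuousl; apply: open_nbhs_nbhs; split=> //.
    by move=> /Wfan.
  by move=> /nbhs_ballP[e /= e0 eW]; exists e => // x /eW.
(* Shrinking [e] when [c] and [d] differ keeps the ray of [d] outside the cone. *)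
pose e' := if c == d then e else Num.min e `|c - d|.
have e'0 : 0 < e'.
  by rewrite /e'; case: eqVneq => // cd; rewrite lt_min e0 normr_gt0 subr_eq0.
have e'e : e' <= e by rewrite /e'; case: eqVneq => // _; rewrite ge_min lexx.
have [qa [ca aC]] := @rat_notin_cantor _ (c - e') c ltac:(lra).
have [qb [cb bC]] := @rat_notin_cantor _ c (c + e') ltac:(lra).
set a : R := ratr qa in ca aC; set b : R := ratr qb in cb bC.
have notab x : cantor_set x -> x != a /\ x != b.
  by move=> xC; split; apply/eqP => xab; move: xC; rewrite xab.
(* The two open sets cover [W]: no ray of the fan lies over [a] or [b], and between them [W] has no
   point at height [h]. The cone contains [u], the exterior contains [v], and the two are
   disjoint. *)
have [|||p [Wp [/= Up Vp]]] := @connected_open_cover _ W _ _ conW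
  (@open_cone a b h) (@open_cone_exterior a b h).
- move=> w /[dup] Ww /Wfan /fanP[x [r [xC r2 wE xr]]]; rewrite wE /=.
  have [/eqP xa /eqP xb] := notab x xC.
  have [rh|hr|rh] := ltgtP r h; [|by right; left|].
    have [xa'|ax|//] := ltgtP x a.
      by right; right; left; nra.
    have [xb'|bx|//] := ltgtP x b; last by right; right; right; nra.
    by left; split=> //; nra.
  have [xa'|ax|//] := ltgtP x a; first by right; right; left; nra.
  have [xb'|bx|//] := ltgtP x b; last by right; right; right; nra.
  exfalso; apply: (eW x); last by rewrite -rh -wE.
  by rewrite ltr_norml; lra.
- exists u; split=> //; rewrite uE/=; split; first lra.
  by nra.
- exists v; split=> //; rewrite vE/=; case: uv => [ts|[ts cd]].
    by left; move: shm; rewrite /m ts; lra.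
  right.
  have [/eqP da /eqP db] := notab d dC.
  have : e' <= `|c - d|.
    by rewrite /e'; case: eqVneq => [/cd//|_]; rewrite ge_min lexx orbT.
  rewrite ler_normr => /orP cd'.
  have [da'|ad|//] := ltgtP d a; first by left; nra.
  have [db'|bd|//] := ltgtP d b; last by right; nra.
  by exfalso; case: cd'; lra.
- by exfalso; case: Up => ph /andP[pa pb]; case: Vp => [|[]]; lra.
Qed.

End Fan.

(** * Connectedness of the fan *)

Section FanDimension.
Context {R : realType}.
Implicit Types (x s : R) (p : R * R).

Lemma cantor_interval_around x n K (e : R) : 0 < e -> cantor_set x ->
  K \in cantor_intervals n -> K.1 <= x <= K.2 ->
  exists n' (J : R * R), [/\ J \in cantor_intervals n', J.1 <= x <= J.2,
    K.1 <= J.1, J.2 <= K.2 & J.2 - J.1 < e].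
Proof.
move=> e0 xC Kn xK; have [m small] := small_cantor_interval e0.
have [J Jmn xJ] := cantor_set_interval (maxn m n) xC.
have [K' K'n [KJ JK]] := cantor_interval_parent (leq_maxr m n) Jmn.
have KK' : K = K' by apply: cantor_intervals_disjoint Kn K'n xK _; lra.
exists (maxn m n), J; rewrite KK'; split=> //.
exact: small (leq_maxl m n) Jmn.
Qed.

(* A separation of the fan leaves, on every ray over an irrational point [x]
   near the part away from the apex, an uncovered point; its height is rational.
   The sets [F q] of the [x] with uncovered height [q] have no interior in the
   Cantor set, as endpoints of removed intervals are dense; Baire concludes. *)
Lemma fan_connected (O1 O2 : set (R * R)) : open O1 -> open O2 ->
  fan R `<=` O1 `|` O2 -> (forall p, fan R p -> O1 p -> O2 p -> False) ->
  O1 fan_apex -> forall p, fan R p -> ~ O2 p.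
Proof.
move=> oO1 oO2 fanO O12 O1a v Xv O2v.
have /fanP[c [h [cC h2 vE ch]]] := Xv.
have {}h2 : 0 <= h < 1 / 2.
  have [||hh] := ltgtP h (1 / 2); [lra|lra|exfalso].
  by apply: (O12 v) => //; rewrite vE hh ray_apex.
have [e e0 eO2] : exists2 e, 0 < e & forall x, `|c - x| < e -> O2 (ray x h).
  have /nbhs_ballP[e /= e0 eO2] : nbhs c ((ray ^~ h) @^-1` O2).
    by apply: ray_continuousl; apply: open_nbhs_nbhs; split=> //; rewrite -vE.
  by exists e => // x /eO2.
have [J00 J000 cJ00] := cantor_set_interval 0 cC.
(* [J0] is so short that [O2] contains the points at height [h] of all rays over it. *)
have [n0 [J0 [J0n cJ0 _ _ J0e]]] := cantor_interval_around e0 cC J000 cJ00.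
(* [unpickle] enumerates the rationals. The first alternative makes the point found by Baire
   irrational, hence no endpoint; the second collects the rays uncovered at height [q]. Indices that
   code nothing give the empty set. *)
pose F (i : nat) : set R := fun x => if unpickle i is Some q then x = ratr q \/
  (0 <= (ratr q : R) <= 1 / 2 /\ ~ (O1 `|` O2) (ray x (ratr q))) else False.
have [|x [xC xJ0 xF]] := @cantor_baire _ F _ _ J0n.
  move=> i n J Jn; rewrite /F; case: (unpickle i) => [q|]; last first.
    by exists n, J; split=> // y _ [].
  (* One of the outer thirds of [J] avoids the number [ratr q] itself. *)
  have [K Kn [JK KJ Kq]] : exists2 K : R * R, K \in cantor_intervals n.+1 &
      [/\ J.1 <= K.1, K.2 <= J.2 & ~ K.1 <= ratr q <= K.2].
    have ltJ := cantor_interval_lt Jn.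
    have [qJ|Jq] := leP (ratr q) (third1 J).
      exists (third2 J, J.2).
        by apply/cantor_intervalsS; exists J; auto.
      by move: qJ; rewrite /third1 /third2 /=; split; lra.
    exists (J.1, third1 J).
      by apply/cantor_intervalsS; exists J; auto.
    by move: Jq; rewrite /third1 /=; split; lra.
  have ltK := cantor_interval_lt Kn.
  have [q2|q2] := pselect (0 <= (ratr q : R) <= 1 / 2); last first.
    by exists n.+1, K; split=> // y yK [yq|[]//]; apply: Kq; rewrite -yq.
  (* Over the endpoint [third1 K] the rational height [q] belongs to the fan, so it is covered
     there, and by openness over all nearby points too. *)
  have K1 := third1_cantor_base1 Kn.
  have K1C : cantor_set (third1 K) by have [[? ? [<-]]] := K1.
  have XK : fan R (ray (third1 K) (ratr q)).
    by apply: fan_ray => //; split=> // _; exists q.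
  have /nbhs_ballP[d /= d0 dO] :
      nbhs (third1 K) ((ray ^~ (ratr q)) @^-1` (O1 `|` O2)).
    apply: ray_continuousl; apply: open_nbhs_nbhs; split; first exact: openU.
    exact: fanO.
  have K1K : K.1 <= third1 K <= K.2 by rewrite /third1; lra.
  have [n' [K' [K'n K1K' KK' K'K K'd]]] := cantor_interval_around d0 K1C Kn K1K.
  exists n', K'; split=> //; [lra|lra|move=> y yK'].
  case=> [yq|[_]]; first by apply: Kq; rewrite -yq; lra.
  apply; apply: dO; rewrite /ball/= ltr_norml; lra.
have xirr : ~ cantor_base1 (x, 0).
  move=> /cantor_base1_rational[q _ qx]; apply: (xF (pickle q)).
  by rewrite /F pickleK; left.
have irr_fan s : h < s < 1 / 2 -> ~ rational s -> fan R (ray x s).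
  by move=> hs sQ; apply: fan_ray => //; lra.
have conI : connected (`]h, 1 / 2[%classic : set R).
  by apply/connected_intervalP; exact: interval_is_interval.
have oU O : open O -> open (ray x @^-1` O).
  by move=> oO; apply: open_comp => // s _; exact: ray_continuous.
(* On the ray of [x], rational heights are covered by the choice of [x], irrational ones because
   they lie in the fan. *)
have [||| s [/=]] := connected_open_cover conI (oU _ oO1) (oU _ oO2).
- move=> s; rewrite /= in_itv/= => hs.
  have [[q _ qs]|sQ] := pselect (rational s); last exact/fanO/irr_fan.
  apply: contrapT => sO; apply: (xF (pickle q)); rewrite /F pickleK; right.
  by rewrite qs; split=> //; lra.
- have /nbhs_ballP[d /= d0 dO] : nbhs (1 / 2 : R) (ray x @^-1` O1).
    by apply: open_nbhs_nbhs; split; [exact: oU|rewrite /= ray_apex].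
  exists (Num.max (1 / 2 - d / 2) ((h + 1 / 2) / 2)); split.
    by rewrite /= in_itv/= lt_max gt_max; lra.
  apply: dO; rewrite /ball/= ltr_norml.
  by case: (leP (1 / 2 - d / 2) ((h + 1 / 2) / 2)); lra.
- have /nbhs_ballP[d /= d0 dO] : nbhs h (ray x @^-1` O2).
    apply: open_nbhs_nbhs; split; first exact: oU.
    by apply: eO2; rewrite ltr_norml; lra.
  exists (Num.min (h + d / 2) ((h + 1 / 2) / 2)); split.
    by rewrite /= in_itv/= gt_min lt_min; lra.
  apply: dO; rewrite /ball/= ltr_norml.
  by case: (leP (h + d / 2) ((h + 1 / 2) / 2)); lra.
- rewrite in_itv/= => hs sO.
  (* The overlap is open, so it contains an irrational height; that point is in the fan, where [O1]
     and [O2] are disjoint. *)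
  have /nbhs_ballP[d /= d0 dO] : nbhs s (ray x @^-1` O1 `&` ray x @^-1` O2).
    by apply: open_nbhs_nbhs; split=> //; apply: openI; exact: oU.
  have [|r [sr rQ]] :=
      @notin_countable R _ s (Num.min (s + d) (1 / 2)) countable_rational.
    by rewrite lt_min; lra.
  rewrite lt_min in sr.
  have [] : (ray x @^-1` O1 `&` ray x @^-1` O2) r.
    by apply: dO; rewrite /ball/= ltr_norml; lra.
  by apply: O12; apply: irr_fan => //; lra.
Qed.

End FanDimension.

(** * Dimensions of the fan *)

Lemma set_val_continuous (T : topologicalType) (A : set T) :
  continuous (set_val : set_type A -> T).
Proof. exact: initial_continuous. Qed.

Lemma closed_set1_set_type (T : topologicalType) (A : set T) (a : set_type A) :
  hausdorff_space T -> closed [set a].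
Proof.
move=> /hausdorff_accessible hT.
rewrite (_ : [set a] = set_val @^-1` [set set_val a]).
  apply: closed_comp => [x _|]; first exact: set_val_continuous.
  exact: accessible_closed_set1.
by apply/seteqP; split=> x /= => [->//|/val_inj].
Qed.

(** The empty set separates: basic sets missing [A] or [B] cover the space, and made disjoint they
    stay open, because only finitely many closed sets are removed from each. *)
Lemma Ind_lt1_clopen_basis (T : topologicalType) (U : nat -> set T) :
  (forall i, open (U i)) -> (forall i, closed (U i)) ->
  (forall x O, open O -> O x -> exists2 i, U i x & U i `<=` O) ->
  Ind_lt 1 T.
Proof.
move=> oU cU bU A B cA cB AB0 /=.
pose G i := if `[< U i `&` A = set0 \/ U i `&` B = set0 >] then U i else set0.
have oG i : open (G i) by rewrite /G; case: ifP => // _; exact: open0.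
have cG i : closed (G i) by rewrite /G; case: ifP => // _; exact: closed0.
pose D := seqDU G.
have oD i : open (D i).
  rewrite /D /seqDU setDE; apply: openI => //; apply: closed_openC.
  by apply: closed_bigsetU => k _; exact: cG.
have GT x : exists i, G i x.
  have [Ax|nAx] := pselect (A x); [have nBx : ~ B x|].
  - by move=> Bx; move: AB0; rewrite -subset0 => /(_ x); apply.
  - have [i Ux UB] := bU x (~` B) (closed_openC cB) nBx.
    exists i; rewrite /G asboolT//; right.
    by apply/disjoints_subset.
  - have [i Ux UA] := bU x (~` A) (closed_openC cA) nAx.
    exists i; rewrite /G asboolT//; left.
    by apply/disjoints_subset.
have DT x : exists i, D i x.
  have [i Gx] := GT x.
  have : (\bigcup_k D k) x by rewrite /D -seqDU_bigcup_eq; exists i.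
  by case=> j _; exists j.
have tD := trivIset_seqDU G.
(* Pieces whose [G i] misses [B] go to the side of [A]; for the others [G i] misses [A]. *)
pose PB i := `[< G i `&` B = set0 >].
exists set0; split; last first.
  by apply/seteqP; split=> // -[x /=]; rewrite in_set0.
split; [exact: closed0|by rewrite set0I|].
exists (\bigcup_(i in PB) D i), (\bigcup_(i in [set i | ~~ PB i]) D i); split.
- exact: bigcup_open.
- exact: bigcup_open.
- apply/seteqP; split=> // x [[i /= Pi Dix] [j /= Pj Djx]].
  have ij : i = j by apply: tD => //; exists x.
  by move: Pj; rewrite -ij Pi.
- apply/seteqP; split=> x _; last by [].
  have [i Dix] := DT x.
  by case: (boolP (PB i)) => Pi; [left|right]; exists i.
have DG i : D i `<=` G i by exact: subDsetl.
split=> x Xx; have [i Dix] := DT x.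
- exists i => //; apply: contrapT => /negP/asboolPn GB.
  have Gx := DG _ _ Dix; move: GB Gx; rewrite /G; case: asboolP => //.
  move=> -[UA _ Ux|UB /(_ UB)//].
  by move: UA; rewrite -subset0 => /(_ x); apply.
- exists i => //=; apply/asboolPn => GB; move: GB; rewrite -subset0 => /(_ x).
  by apply; split=> //; exact: DG.
Qed.

Section FanInd.
Context {R : realType}.
Implicit Types (x s : R) (p : R * R).

Lemma fan_neq0 : [set: set_type (fan R)] <> set0.
Proof.
by move/seteqP => [/(_ (SigSub (mem_set (@fan_apex_in R))))] X0 _; exact: X0.
Qed.

(** The apex and a point at height 0 would have an empty separator, which would split the connected
    fan. *)
Lemma fan_not_Ind_lt1 : ~ Ind_lt 1 (set_type (fan R)).
Proof.
have x1 : cantor_base1 (third1 (0, 1) : R, 0).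
  by apply: (@third1_cantor_base1 _ 0); rewrite inE.
have Xv : fan R (ray (third1 (0, 1)) 0).
  apply: fan_ray; [by have [[? ? [<-]]] := x1|lra|split=> // _].
  by exists 0 => //; rewrite raddf0.
pose v : set_type (fan R) := SigSub (mem_set Xv).
pose a : set_type (fan R) := SigSub (mem_set (@fan_apex_in R)).
have va : v <> a.
  by move=> /(congr1 (fun y : set_type (fan R) => (set_val y).2)) /=; lra.
have cl1 (b : set_type (fan R)) : closed [set b].
  by apply: closed_set1_set_type; exact: norm_hausdorff.
have av0 : [set a] `&` [set v] = set0.
  by apply/seteqP; split=> // y [/= -> av]; exact: va (esym av).
move=> /(_ [set a] [set v] (cl1 a) (cl1 v) av0).
move=> [S [[_ _ [U [V [[P1 oP1 <-] [P2 oP2 <-] UV0 UVT [aU vV]]]]] S0]].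
apply: (@fan_connected _ P1 P2 oP1 oP2 _ _ _ _ Xv).
- move=> p Xp; pose q : set_type (fan R) := SigSub (mem_set Xp).
  suff : (~` S) q by rewrite UVT.
  move=> Sq; have : [set: set_type S] (SigSub (mem_set Sq)) by [].
  by rewrite S0.
- move=> p Xp P1p P2p; pose q : set_type (fan R) := SigSub (mem_set Xp).
  by move: UV0; rewrite -subset0 => /(_ q); apply.
- exact: (aU a).
- exact: (vV v).
Qed.

(* Cones between two gaps of the Cantor set, cut at two rational heights, form
   a countable clopen basis of the set of points of irrational height. *)
Lemma Ind_lt1_irrational (S : set (set_type (fan R))) :
  (forall q : set_type (fan R), S q -> irrational (set_val q).2) ->
  Ind_lt 1 (set_type S).
Proof.
move=> SQ; pose proj (p : set_type S) : R * R := set_val (set_val p).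
have proj_cont : continuous proj.
  move=> p; apply: (@continuous_comp _ _ _ (set_val : set_type S -> _)).
    exact: set_val_continuous.
  exact: set_val_continuous.
(* An irrational height excludes the apex, so [1 - 2 * s] is positive. *)
have projE (p : set_type S) : exists x s, [/\ cantor_set x, 0 <= s < 1 / 2,
    proj p = ray x s & irrational s].
  have /fanP[x [s [xC s2 pE xs]]] : fan R (proj p) := set_valP (set_val p).
  have : irrational (proj p).2 := SQ _ (set_valP p); rewrite pE /= => sQ.
  exists x, s; split=> //; have [||sE] := ltgtP s (1 / 2); [lra|lra|].
  by exfalso; apply: sQ; exists (1 / 2).
pose box (a b l h : R) : set (R * R) :=
  [set p | p.2 < h /\ (1 - 2 * p.2) * a < p.1 - p.2 < (1 - 2 * p.2) * b] `&`
  [set p | l < p.2].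
have obox a b l h : open (box a b l h).
  by apply: openI; [exact: open_cone|exact: open_above].
pose out (a b l h : R) : set (R * R) := [set p | h < p.2 \/
  p.1 - p.2 < (1 - 2 * p.2) * a \/ (1 - 2 * p.2) * b < p.1 - p.2] `|`
  [set p | p.2 < l].
have oout a b l h : open (out a b l h).
  by apply: openU; [exact: open_cone_exterior|exact: open_below].
pose good (u : (rat * rat) * (rat * rat)) :=
  ~ cantor_set (ratr u.1.1 : R) /\ ~ cantor_set (ratr u.1.2 : R).
pose bx (u : (rat * rat) * (rat * rat)) : set (set_type S) :=
  proj @^-1` box (ratr u.1.1) (ratr u.1.2) (ratr u.2.1) (ratr u.2.2).
have obx u : open (bx u).
  by apply: open_comp => // p _; exact: proj_cont.
(* No point of [S] lies on the boundary of such a box: its sides start in gaps of the Cantor set and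
   its two heights are rational. *)
have cbx u : good u -> closed (bx u).
  move=> [aC bC]; rewrite -openC.
  rewrite (_ : ~` bx u =
      proj @^-1` out (ratr u.1.1) (ratr u.1.2) (ratr u.2.1) (ratr u.2.2)).
    by apply: open_comp => // p _; exact: proj_cont.
  apply/seteqP; split=> p; rewrite /bx /box /out /=.
  - have [x [s [xC s2 -> sQ]]] := projE p; rewrite /ray /= => nbox.
    have [xa|ax|xa] := ltgtP x (ratr u.1.1); last by rewrite -xa in aC.
      by left; right; left; nra.
    have [xb|bx'|xb] := ltgtP x (ratr u.1.2); last by rewrite -xb in bC.
      have [sl|ls|sl] := ltgtP s (ratr u.2.1); first by right.
        have [sh|hs|sh] := ltgtP s (ratr u.2.2); last by case: sQ; exists u.2.2.
          exfalso; apply: nbox; split=> //; split=> //.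
          by apply/andP; split; nra.
        by left; left.
      by case: sQ; exists u.2.1.
    by left; right; right; nra.
  - move=> outp [[ph /andP[pa pb]] pl].
    by case: outp => [[|[|]]|]; lra.
pose U i := if unpickle i is Some u then
  if `[< good u >] then bx u else set0 else set0.
apply: (@Ind_lt1_clopen_basis _ U).
- move=> i; rewrite /U; case: unpickle => [u|]; last exact: open0.
  by case: ifP => // _; exact: open0.
- move=> i; rewrite /U; case: unpickle => [u|]; last exact: closed0.
  by case: asboolP => [/cbx|_] //; exact: closed0.
- move=> p _ [_ [W oW <-] <-] Wp.
  have [x [s [xC s2 pE sQ]]] := projE p.
  (* The box is chosen in the coordinates [(x, s)], where a small rectangle is mapped into [W]. *)
  have /nbhs_ballP[e /= e0 eW] : nbhs (x, s) ((fun u => ray u.1 u.2) @^-1` W).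
    apply: ray_continuous2; apply: open_nbhs_nbhs; split=> //=.
    by rewrite -pE.
  have [qa [ca aC]] := @rat_notin_cantor _ (x - e) x ltac:(lra).
  have [qb [cb bC]] := @rat_notin_cantor _ x (x + e) ltac:(lra).
  have [ql] := @rat_in_itvoo _ (s - e) s ltac:(lra).
  have [qh] := @rat_in_itvoo _ s (s + e) ltac:(lra).
  rewrite !in_itv/= => sh ls.
  exists (pickle ((qa, qb), (ql, qh))); rewrite /U pickleK asboolT//.
    rewrite /bx /box /= pE /ray/=; split; last lra.
    by split; [lra|apply/andP; split; nra].
  move=> y; rewrite /bx /box /=.
  have [x' [s' [x'C s'2 yE s'Q]]] := projE y.
  rewrite yE /ray/= => -[[s'h /andP[ax' x'b]] ls'].
  suff : W (proj y) by [].
  rewrite yE; apply: (eW (x', s')).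
  have ltx : ratr qa < x' by nra.
  have ltb : x' < ratr qb by nra.
  by split; rewrite /ball/= ltr_norml; lra.
Qed.

Lemma fan_Ind_lt2 : Ind_lt 2 (set_type (fan R)).
Proof.
move=> A B cA cB AB0.
have [f [cf fA fB _]] :=
  @urysohn_ext_itv _ R (@pseudometric_normal R (set_type (fan R))) _ _ 0 1
    cA cB AB0 ltr01.
pose Q := [set p : set_type (fan R) | rational (set_val p).2].
(* A point of rational height lies over an endpoint, which is rational too, so pairs of rationals
   code these points. The default 0 of [g] serves pairs that code no point of the fan. *)
have cQ : countable (f @` Q).
  pose g (u : rat * rat) : R := xget 0 [set y | exists2 p : set_type (fan R),
    set_val p = ray (ratr u.1) (ratr u.2) & y = f p].
  apply: (@sub_countable _ _ _ (range g)); last first.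
    exact: card_le_trans (card_image_le _ _) (countableP _).
  apply: subset_card_le => _ [p Qp <-].
  have /fanP[x [s [xC s2 pE xs]]] : fan R (set_val p) := set_valP p.
  have [r _ rs] : rational s by move: Qp; rewrite /Q /= pE.
  have [q _ qx] : rational x by apply/cantor_base1_rational/xs; exists r.
  exists (q, r) => //; apply: xget_unique; first by exists p; rewrite //= qx rs.
  move=> _ [p' p'E ->]; congr f; apply: val_inj.
  by rewrite -[LHS]/(set_val p') p'E /= qx rs -pE.
have [r [r01 rQ]] := notin_countable cQ (@ltr01 R).
exists (f @^-1` [set r]); split; last first.
  apply: Ind_lt1_irrational => p /= fp pQ; apply: rQ.
  by exists p.
split.
- by apply: closed_comp => [x _|]; [exact: cf|exact: closed_eq].
- apply/seteqP; split=> // x [/= fx [/(imageP f)/fA|/(imageP f)/fB]] /=; lra.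
- exists (f @^-1` [set y | y < r]), (f @^-1` [set y | r < y]); split.
  + by apply: open_comp => [x _|]; [exact: cf|exact: open_lt].
  + by apply: open_comp => [x _|]; [exact: cf|exact: open_gt].
  + by apply/seteqP; split=> // x [/=]; lra.
  + apply/seteqP; split=> x /=.
      by have [fx|fx|] := ltgtP (f x) r; [left|right|].
    by case=> + fxr; rewrite fxr ltxx.
  + split=> x.
    * by move=> /(imageP f)/fA /= ->; lra.
    * by move=> /(imageP f)/fB /= ->; lra.
Qed.

Lemma Ind_fan : Ind (set_type (fan R)) = 1%:E.
Proof.
have ge2 m : Ind_lt m (set_type (fan R)) -> (2 <= m)%N.
  by case: m => [/fan_neq0//|[/fan_not_Ind_lt1//|//]].
(* The least index is 2 because [Ind_lt 2] stands for dimension at most 1. *)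
apply: xget_unique; first by exists 2; split=> //; exact: fan_Ind_lt2.
move=> _ [n [-> nX nmin]]; have := ge2 _ nX; have := nmin _ fan_Ind_lt2.
by move=> n2 n2'; have -> : n = 2 by apply/eqP; rewrite eqn_leq n2.
Qed.

(** As [K] is nonempty, a member would supply a line of sight; its image in the plane would be a
    compact connected subset of the fan with two distinct points. *)
Lemma fan_Ab_family1 : Ab_family (set_type (fan R)) 1 = set0.
Proof.
apply/seteqP; split=> // Y [K [_ [k Kk] KY [z [nKz sight]]]].
pose x : set_type Y := SigSub (mem_set (KY k Kk)).
have [W [[[xz _ _] [[cptW conW _] Wx Wz] _ _] _]] := sight x Kk.
pose proj (y : set_type Y) : R * R := set_val (set_val y).
have proj_cont : {within W, continuous proj}.
  apply: continuous_subspaceT => y.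
  apply: (@continuous_comp _ _ _ (set_val : set_type Y -> _)).
    exact: set_val_continuous.
  exact: set_val_continuous.
have := @punctiform_fan R (proj @` W) (continuous_compact proj_cont cptW)
  (connected_continuous_connected conW proj_cont).
move=> /(_ _ (proj x) (proj z)) xz'; apply: xz; do 2!apply: val_inj.
apply: xz'; [|by exists x|by exists z].
by move=> _ [y _ <-]; exact: set_valP.
Qed.

Lemma Ab_fan : Ab (set_type (fan R)) = 0%:E.
Proof.
rewrite /Ab asboolF; last exact: fan_neq0.
have le0 m : Ab_family (set_type (fan R)) m !=set0 -> (m <= 0)%N.
  (* A member of a later collection needs some [K] in the preceding one, so emptiness passes
     upwards. *)
  elim: m => [//|[|m] IHm]; first by rewrite fan_Ab_family1 => -[].
  by move=> [Y [K [Km _ _ _]]]; have := IHm (ex_intro _ K Km).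
apply: xget_unique; first by exists 0; split=> //; exists setT.
by move=> _ [n [-> /le0]]; rewrite leqn0 => /eqP ->.
Qed.

End FanInd.

Theorem theorem4p1 (R : realType) :
  Ab (set_type (fan R)) = 0%:E /\ Ind (set_type (fan R)) = 1%:E.
Proof. by split; [exact: Ab_fan|exact: Ind_fan]. Qed.
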